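(* For every triple of positive integers $r,k,g$ with $r\ge 3$, there exists a tranquil $r$-uniform hypergraph with chromatic number at least $k$ and girth at least $g$.
   Context: A closed walk of length $\ell$ in a hypergraph $H$ is a sequence $v_0F_0v_1F_1\ldots F_{\ell-1}v_0$ of alternating vertices and hyperedges such that $v_i,v_{i+1}\in F_i$ for all $0\le i<\ell$ (indices mod $\ell$), $F_i\neq F_{i+1}$ for each $0\le i<\ell$ (indices mod $\ell$), and $v_1,\ldots,v_{\ell-1}$ are pairwise distinct. An $r$-uniform hypergraph $H$ is tranquil if there is a family of labellings $\lambda=\{\lambda_F\}_{F\in E(H)}$, with $\lambda_F:F\to\{1,\ldots,r\}$, such that for every closed walk $W=v_0F_0v_1\ldots F_{\ell-1}v_0$ of $H$, the multigraph with vertex set $\{1,\ldots,r\}$ and edge multiset $\{\lambda_{F_i}(v_i)\lambda_{F_i}(v_{i+1}) : 0\le i<\ell\}$ is bridgeless. The chromatic number of a hypergraph is the least number of colours needed to colour its vertices so that no hyperedge is monochromatic. Distinct hyperedges $F_1,\ldots,F_\ell$ form a (Berge) cycle of length $\ell$ if there are distinct vertices $x_1,\ldots,x_\ell$ with $x_i\in F_i\cap F_{i+1}$ for all $i$ (indices mod $\ell$); the girth of a hypergraph is the length of its shortest Berge cycle. *)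

(* Defs.v *)
From mathcomp Require Import all_boot.
Set Implicit Arguments. Unset Strict Implicit. Unset Printing Implicit Defensive.

Definition uniform (V : finType) (r : nat) (E : {set {set V}}) : Prop :=
  forall F, F \in E -> #|F| = r.

(* A multigraph on vertex set 'I_r given by an edge family e indexed by a
   finite type I (each index is one edge, loops/parallel edges allowed).
   Edge j is a bridge iff its endpoints are not connected after deleting j. *)
Definition bridgeless (r : nat) (I : finType) (e : I -> 'I_r * 'I_r) : Prop :=
  forall j : I,
    connect (fun x y : 'I_r =>
               [exists i : I, (i != j) &&
                  ((((e i).1 == x) && ((e i).2 == y)) ||
                   (((e i).1 == y) && ((e i).2 == x)))])
            (e j).1 (e j).2.

(* Closed walk v_0 F_0 v_1 ... F_{l-1} v_0, indices mod l (ordS i = i+1 mod l). *)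
Definition closed_walk (V : finType) (E : {set {set V}}) (l : nat)
  (v : 'I_l -> V) (F : 'I_l -> {set V}) : Prop :=
  (forall i, F i \in E) /\
  (forall i, v i \in F i /\ v (ordS i) \in F i) /\
  (forall i, F i != F (ordS i)) /\
  (forall i j : 'I_l, 0 < nat_of_ord i -> 0 < nat_of_ord j -> v i = v j -> i = j).

(* A labelling of F is a bijection F -> {1..r} (here 'I_r), i.e. injective on F
   since |F| = r. *)
Definition tranquil (V : finType) (r : nat) (E : {set {set V}}) : Prop :=
  exists lam : {set V} -> V -> 'I_r,
    (forall F, F \in E -> {in F &, injective (lam F)}) /\
    forall (l : nat) (v : 'I_l -> V) (F : 'I_l -> {set V}),
      closed_walk E v F ->
      bridgeless (fun i : 'I_l => (lam (F i) (v i), lam (F i) (v (ordS i)))).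

Definition proper_colouring (V : finType) (E : {set {set V}}) (m : nat)
  (c : V -> 'I_m) : Prop :=
  forall F, F \in E -> exists x y, [/\ x \in F, y \in F & c x != c y].

Definition chromatic_ge (V : finType) (E : {set {set V}}) (k : nat) : Prop :=
  forall m, m < k -> ~ exists c : V -> 'I_m, proper_colouring E c.

Definition berge_cycle (V : finType) (E : {set {set V}}) (l : nat)
  (F : 'I_l -> {set V}) (x : 'I_l -> V) : Prop :=
  [/\ 2 <= l, forall i, F i \in E, injective F, injective x &
      forall i, x i \in F i /\ x i \in F (ordS i)].

Definition girth_ge (V : finType) (E : {set {set V}}) (g : nat) : Prop :=
  forall l (F : 'I_l -> {set V}) (x : 'I_l -> V), berge_cycle E F x -> g <= l.

(* Main.v *)
(** A family of [r]-edges labelled by an alphabet [A] is called tranquil here if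
    every partition of [A] is induced, along all the labellings at once, by a
    partition of the vertices.  This implies the tranquillity of closed walks:
    partition the labels by connectivity in the multigraph without its [j]-th
    edge; every step of the walk other than the [j]-th one stays inside a
    vertex class, hence so does the [j]-th one, whose ends therefore have
    connected labels.

    The combinatorial lines of [A^I] form a tranquil family (partition words
    coordinatewise), and by the Hales-Jewett theorem its chromatic number is
    arbitrarily large.  The girth is then increased one unit at a time by the
    partite amalgamation of Nesetril and Rodl: starting from disjoint edges,
    one for each injection of [A] into a set of parts, each part [X] in turn is
    glued along all edges of an [X]-uniform family of smaller girth.
    Amalgamation preserves tranquillity, because the partition of [X] induced
    by the amalgamated system is itself realised in the [X]-uniform family. *)

Require Import Defs.
From mathcomp Require Import all_boot.
From mathcomp Require Import zify.
Set Implicit Arguments. Unset Strict Implicit. Unset Printing Implicit Defensive.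

(** * The Hales-Jewett theorem, by colour focusing *)

(** Combinatorial lines are given by templates whose moving coordinates are the
    ones equal to [None]. *)
Definition fill (A I : finType) (L : {ffun I -> option A}) (a : A) :
  {ffun I -> A} := [ffun i => odflt a (L i)].

Definition moving (A I : finType) (L : {ffun I -> option A}) :=
  [exists i, L i == None].

Definition hales_jewett (A : finType) : Prop :=
  forall K : finType, exists I : finType, forall c : {ffun I -> A} -> K,
    exists L : {ffun I -> option A}, moving L /\
      exists y, forall a, c (fill L a) = y.

Lemma hales_jewett_unit : hales_jewett unit.
Proof.
move=> K; exists unit => c; exists [ffun=> None]; split.
  by apply/existsP; exists tt; rewrite ffunE.
by exists (c (fill [ffun=> None] tt)) => -[].
Qed.

Definition join_words (A I J : finType) (u : {ffun I -> A}) (v : {ffun J -> A}) :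
  {ffun I + J -> A} :=
  [ffun k => match k with inl i => u i | inr j => v j end].

Definition consts (A I : finType) (u : {ffun I -> A}) : {ffun I -> option A} :=
  [ffun i => Some (u i)].

Definition lift_template (A I : finType) (L : {ffun I -> option A}) :
  {ffun I -> option (option A)} := [ffun i => omap Some (L i)].

Lemma fill_join_words (A I J : finType) (L : {ffun I -> option A})
    (M : {ffun J -> option A}) a :
  fill (join_words L M) a = join_words (fill L a) (fill M a).
Proof. by apply/ffunP => -[i|j]; rewrite !ffunE. Qed.

Lemma fill_consts (A I : finType) (u : {ffun I -> A}) a : fill (consts u) a = u.
Proof. by apply/ffunP => i; rewrite !ffunE. Qed.

Lemma fill_lift (A I : finType) (L : {ffun I -> option A}) a :
  fill (lift_template L) (Some a) = [ffun i => Some (fill L a i)].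
Proof. by apply/ffunP => i; rewrite !ffunE; case: (L i). Qed.

Lemma moving_join_wordsl (A I J : finType) (L : {ffun I -> option A})
    (M : {ffun J -> option A}) : moving L -> moving (join_words L M).
Proof.
by move=> /existsP[i Li]; apply/existsP; exists (inl i); rewrite ffunE.
Qed.

Lemma moving_join_wordsr (A I J : finType) (L : {ffun I -> option A})
    (M : {ffun J -> option A}) : moving M -> moving (join_words L M).
Proof.
by move=> /existsP[i Mi]; apply/existsP; exists (inr i); rewrite ffunE.
Qed.

Lemma moving_lift (A I : finType) (L : {ffun I -> option A}) :
  moving L -> moving (lift_template L).
Proof.
move=> /existsP[i Li]; apply/existsP; exists i.
by rewrite ffunE (eqP Li).
Qed.

(** Here [None] is the extra letter of the alphabet: the lines meet in the
    focus [p], and off the focus they are monochromatic. *)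
Definition focused (A I K : finType) (c : {ffun I -> option A} -> K)
    (p : {ffun I -> option A}) (s : seq K) : Prop :=
  forall y, y \in s -> exists L : {ffun I -> option (option A)},
    [/\ moving L, fill L None = p & forall a, c (fill L (Some a)) = y].

(** Induction on the number of focused lines. Hales-Jewett over [A], applied with whole colourings
    of the words on [I] as colours, yields a line on fresh coordinates [J] whose old letters all
    induce the same colouring [g]; the induction hypothesis is then applied to [g]. *)
Lemma colour_focusing (A K : finType) (a0 : A) (t : nat) :
  hales_jewett A ->
  exists I : finType, forall c : {ffun I -> option A} -> K,
    (exists L, moving L /\ exists y, forall a, c (fill L a) = y) \/
    exists p s, [/\ uniq s, size s = t & focused c p s].
Proof.
move=> HJ; elim: t => [|t [I IH]].
  by exists unit => c; right; exists [ffun=> None], [::]; split.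
have [J HJJ] := HJ {ffun {ffun I -> option A} -> K}.
exists (I + J)%type => c.
pose C (v : {ffun J -> A}) := [ffun u => c (join_words u [ffun j => Some (v j)])].
have [L [mL [g Lg]]] := HJJ C.
have cE u a : c (join_words u (fill (lift_template L) (Some a))) = g u.
  by rewrite -(Lg a) ffunE fill_lift.
case: (IH g) => [[M [mM [y My]]]|[p [s [us st fs]]]].
  (* Any old letter may fill the coordinates in [J], since [g] does not depend on it. *)
  left; exists (join_words M (consts (fill (lift_template L) (Some a0)))).
  split; first exact: moving_join_wordsl.
  by exists y => a; rewrite fill_join_words fill_consts cE.
(* If the focus [p] has the colour of one of its lines, that line is monochromatic with [None]
   included. Otherwise [p] itself contributes a new colour: the new line moves only in [J], and each
   old line is made to move in [J] as well. *)
have [gps|gps] := boolP (g p \in s).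
  have [M [mM Mp Ms]] := fs _ gps.
  left; exists (join_words M (consts (fill (lift_template L) (Some a0)))).
  split; first exact: moving_join_wordsl.
  exists (g p) => a; rewrite fill_join_words fill_consts cE.
  by case: a => [a|]; rewrite ?Ms ?Mp.
right; exists (join_words p (fill (lift_template L) None)), (g p :: s).
split; rewrite /= ?us ?gps ?st // => y; rewrite inE => /predU1P[->|ys].
  exists (join_words (consts p) (lift_template L)); split.
  - exact/moving_join_wordsr/moving_lift.
  - by rewrite fill_join_words fill_consts.
  - by move=> a; rewrite fill_join_words fill_consts cE.
have [M [mM Mp Ms]] := fs _ ys.
exists (join_words M (lift_template L)); split.
- exact: moving_join_wordsl.
- by rewrite fill_join_words Mp.
- by move=> a; rewrite fill_join_words cE Ms.
Qed.

(** With [#|K|] distinct colours focused at [p], the colour of [p] must be one of them. *)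
Lemma hales_jewett_option (A : finType) (a0 : A) :
  hales_jewett A -> hales_jewett (option A).
Proof.
move=> HJ K; have [I HI] := colour_focusing K a0 #|K| HJ.
exists I => c; case: (HI c) => // -[p [s [us sK fs]]].
have [|L [mL Lp Ls]] := fs (c p).
  have /eqP/setP/(_ (c p)) : [set x in s] == setT.
    by rewrite eqEcard subsetT cardsT cardsE (card_uniqP us) sK /=.
  by rewrite !inE.
by exists L; split=> //; exists (c p) => -[a|]; rewrite ?Ls ?Lp.
Qed.

Fixpoint alphabet (n : nat) : finType :=
  if n is m.+1 then option (alphabet m) else unit.

Lemma card_alphabet n : #|alphabet n| = n.+1.
Proof. by elim: n => [|n IH] /=; rewrite ?card_unit // card_option IH. Qed.

Lemma hales_jewett_alphabet n : hales_jewett (alphabet n).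
Proof.
elim: n => [|n IH]; first exact: hales_jewett_unit.
suff [a0] : inhabited (alphabet n) by apply: (hales_jewett_option a0).
by case: (n) => [|m]; split; [exact: tt | exact: None].
Qed.

(** * Tranquil, Ramsey and sparse families of labelled edges *)

(** Partitions are represented as kernels of functions. *)
Definition tranquil_family (V E A : finType) (e : E -> A -> V) : Prop :=
  forall (T : finType) (f : A -> T), exists (U : finType) (q : V -> U),
    forall j a b, (q (e j a) == q (e j b)) = (f a == f b).

Definition ramsey_family (V E A K : finType) (e : E -> A -> V) : Prop :=
  forall c : V -> K, exists j y, forall a, c (e j a) = y.

Definition support (V E A : finType) (e : E -> A -> V) (S : {set E}) : {set V} :=
  \bigcup_(j in S) [set e j a | a : A].

(** For an [r]-uniform family, a Berge cycle of length [l] is a set of [l] edges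
    covering at most [l * (r - 1)] vertices. *)
Definition sparse (g : nat) (V E A : finType) (e : E -> A -> V) : Prop :=
  forall S : {set E}, S != set0 -> #|S| < g ->
    #|S| * #|A|.-1 < #|support e S|.

Lemma supportP (V E A : finType) (e : E -> A -> V) (S : {set E}) x :
  reflect (exists2 j, j \in S & exists a, x = e j a) (x \in support e S).
Proof.
apply: (iffP bigcupP) => [[j jS /imsetP[a _ ->]]|[j jS [a ->]]].
  by exists j => //; exists a.
by exists j => //; apply: imset_f.
Qed.

Lemma tranquil_family_inj (V E A : finType) (e : E -> A -> V) j :
  tranquil_family e -> injective (e j).
Proof.
move=> /(_ A id)[U [q qE]] a b ab; apply/eqP.
by rewrite -(qE j) ab.
Qed.

Definition has_system (g : nat) (A K : finType) : Prop :=
  exists (V E : finType) (e : E -> A -> V),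
    [/\ tranquil_family e, ramsey_family K e & sparse g e].

(** Hales-Jewett is available for [alphabet n], whereas amalgamation takes a part of a system, an
    arbitrary nonempty type, as its alphabet. *)
Lemma has_system_card (g : nat) (A B K : finType) :
  #|A| = #|B| -> has_system g A K -> has_system g B K.
Proof.
move=> AB [V [E [e [te re se]]]].
pose h (b : B) : A := enum_val (cast_ord (esym AB) (enum_rank b)).
pose h' (a : A) : B := enum_val (cast_ord AB (enum_rank a)).
have hK : cancel h h' by move=> b; rewrite /h' /h enum_valK cast_ordKV enum_rankK.
have h'K : cancel h' h by move=> b; rewrite /h' /h enum_valK cast_ordK enum_rankK.
exists V, E, (fun j b => e j (h b)); split.
- move=> T f; have [U [q qE]] := te T (f \o h').
  by exists U, q => j a b; rewrite qE /= !hK.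
- by move=> c; have [j [y jy]] := re c; exists j, y.
- move=> S S0 Sg; rewrite -AB; apply: leq_trans (se S S0 Sg) _.
  apply/subset_leq_card/subsetP => x /supportP[j jS [a ->]].
  by apply/supportP; exists j => //; exists (h' a); rewrite h'K.
Qed.

Lemma has_system1 (A K : finType) : 0 < #|A| -> has_system 1 A K.
Proof.
move=> A0; apply: (@has_system_card _ (alphabet #|A|.-1)).
  by rewrite card_alphabet prednK.
move: (alphabet _) (hales_jewett_alphabet #|A|.-1) => {A0}A HJ.
have [I HI] := HJ K.
exists {ffun I -> A}, {L : {ffun I -> option A} | moving L},
  (fun L => fill (val L)); split.
- move=> T f; exists {ffun I -> T}, 
    (fun w : {ffun I -> A} => [ffun i => f (w i)]).
  move=> [L /= /existsP[i Li]] a b; apply/eqP/eqP => [/ffunP/(_ i)|fab].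
    by rewrite !ffunE (eqP Li).
  by apply/ffunP => k; rewrite !ffunE; case: (L k).
- by move=> c; have [L [mL [y Ly]]] := HI c; exists (exist _ L mL), y.
- by move=> S; rewrite -card_gt0 ltnS leqn0 => /lt0n_neq0/negbTE->.
Qed.

(** * Partite systems *)

(** The parts in [J] are those which have already been made monochromatic. *)
Definition partite_system (g : nat) (A I K : finType) (J : seq I) : Prop :=
  exists (V E : finType) (e : E -> A -> V) (part : V -> I),
    [/\ tranquil_family e, sparse g e, forall j, injective (part \o e j) &
        forall c : V -> K, exists y : I -> K, forall s : A -> I, injective s ->
          exists j, (forall a, part (e j a) = s a) /\
                    forall a, s a \in J -> c (e j a) = y (s a)].

Lemma partite_system0 (g : nat) (A I K : finType) (y0 : K) :
  0 < #|A| -> partite_system g A K ([::] : seq I).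
Proof.
move=> A0; pose E : finType := {s : {ffun A -> I} | injectiveb s}.
exists (E * A)%type, E, pair, (fun x : E * A => val x.1 x.2); split.
- move=> T f; exists (E * T)%type, (fun x => (x.1, f x.2)) => j a b.
  by rewrite xpair_eqE eqxx.
- move=> S S0 _.
  have -> : support pair S = setX S [set: A].
    apply/setP => -[j a]; rewrite !inE andbT; apply/supportP/idP => /=.
      by case=> k kS [b [-> _]].
    by move=> jS; exists j => //; exists a.
  by rewrite cardsX cardsT ltn_pmul2l ?prednK // card_gt0.
- by move=> j a b /= ab; have /injectiveP := valP j; apply.
- move=> c; exists (fun=> y0) => s inj_s.
  have sP : injectiveb [ffun a => s a].
    by apply/injectiveP => a b; rewrite !ffunE; apply: inj_s.
  by exists (Sub [ffun a => s a] sP : E); split=> // a /=; rewrite ffunE.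
Qed.

Lemma card_pairs (T U : finType) (S : {set T * U}) :
  #|S| = \sum_t #|[set x | (t, x) \in S]|.
Proof.
under eq_bigr do rewrite -sum1dep_card.
by rewrite pair_big_dep -sum1_card; apply: eq_bigl => -[].
Qed.

Lemma leq_card_bigcup (T U : finType) (P : {pred T}) (F : T -> {set U}) :
  #|\bigcup_(t in P) F t| <= \sum_(t in P) #|F t|.
Proof.
apply: (big_ind2 (fun (A : {set U}) n => #|A| <= n)) => [|A m B n Am Bn|//].
  by rewrite cards0.
by apply: leq_trans (leq_card_setU A B) _; apply: leq_add.
Qed.

(** * Partite amalgamation *)

Section Amalgam.

Variables (V E A I W D : finType) (e : E -> A -> V) (part : V -> I) (i : I).
Let X : finType := {x : V | part x == i}.
Variable d : D -> X -> W.

(** Every [t : D] gets a copy of [V] whose part [i] is identified with the edge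
    [d t]; the points [inr (t, x)] with [x] in part [i] are left isolated. *)
Definition glue (t : D) (x : V) : W + D * V :=
  match insub x : option X with
  | Some y => inl (d t y)
  | None => inr (t, x)
  end.

Definition amalgam (k : D * E) (a : A) : W + D * V := glue k.1 (e k.2 a).

Definition amalgam_part (z : W + D * V) : I :=
  match z with inl _ => i | inr tx => part tx.2 end.

Lemma glueE t (x : X) : glue t (val x) = inl (d t x).
Proof. by rewrite /glue valK. Qed.

Lemma glue_out t x : part x != i -> glue t x = inr (t, x).
Proof. by move=> xi; rewrite /glue insubN. Qed.

Lemma amalgam_part_glue t x : amalgam_part (glue t x) = part x.
Proof.
by rewrite /glue; case: insubP => //= y /eqP.
Qed.

Lemma tranquil_amalgam :
  tranquil_family e -> tranquil_family d -> tranquil_family amalgam.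
Proof.
move=> te td T f; have [U [q qE]] := te T f.
have [UB [qB qBE]] := td U (q \o val).
(* A class meeting part [i] is identified with a class of [W]. *)
pose psi t (u : U) : UB + D * U :=
  if [pick y : X | q (val y) == u] is Some y then inl (qB (d t y))
  else inr (t, u).
(* On the edge [d t], [qB] separates points exactly as [q] does, so no two classes of a copy are
   merged. *)
have psi_inj t : injective (psi t).
  move=> u v; rewrite /psi.
  case: pickP => [y /eqP <-|_]; case: pickP => [z /eqP <-|_] // [].
    by move=> /eqP; rewrite qBE => /eqP.
  by [].
pose Q (z : W + D * V) : UB + D * U :=
  match z with inl w => inl (qB w) | inr tx => psi tx.1 (q tx.2) end.
have QE t x : Q (glue t x) = psi t (q x).
  rewrite /glue; case: insubP => [y _ <-|//] /=.
  rewrite /psi; case: pickP => [z zy|/(_ y)]; last by rewrite eqxx.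
  by congr inl; apply/eqP; rewrite qBE /= eq_sym.
exists (UB + D * U)%type, Q => -[t j] a b.
by rewrite /amalgam /= !QE (inj_eq (@psi_inj t)) qE.
Qed.

(** Vertices are counted copy by copy. In each copy [t] in [T], sparsity of [e] gives one vertex
    more than [#|F t| * #|A|.-1], a total surplus of [#|T|]. Gluing the sets [Y t] into [Z] costs
    [\sum_(t in T) #|Y t| - #|Z|] vertices, which [key] shows to be less than this surplus. *)
Lemma sparse_amalgam (g : nat) :
  0 < g -> 0 < #|A| -> 0 < #|X| -> (forall j, injective (part \o e j)) ->
  (forall t, injective (d t)) ->
  sparse g.+1 e -> sparse g d -> sparse g.+1 amalgam.
Proof.
move=> g0 A0 X0 inj_part inj_d se sd S S0 Sg.
pose T := [set k.1 | k in S].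
pose F t := [set j | (t, j) \in S].
pose P t := support e (F t).
pose Y t := [set x : X | val x \in P t].
pose Z := \bigcup_(t in T) [set d t x | x in Y t].
have T0 : 0 < #|T|.
  by rewrite card_gt0; case/set0Pn: S0 => k kS; apply/set0Pn; exists k.1; apply: imset_f.
have TS : #|T| <= #|S| by apply: leq_imset_card.
have cardS : #|S| = \sum_(t in T) #|F t|.
  rewrite card_pairs [RHS]big_mkcond; apply: eq_bigr => t _.
  case: ifPn => // tT; apply/eqP; rewrite cards_eq0; apply: contraNT tT.
  by case/set0Pn=> j; rewrite inE => tj; apply/imsetP; exists (t, j).
have F0 t : t \in T -> 0 < #|F t|.
  case/imsetP=> -[t' j] tj ->; rewrite card_gt0; apply/set0Pn; exists j.
  by rewrite inE.
have FS t : #|F t| <= #|S|.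
  rewrite -(card_imset _ (_ : injective (pair t))); last by move=> ? ? [].
  apply/subset_leq_card/subsetP => k /imsetP[j]; rewrite inE => ? -> //.
have Pbig t : t \in T -> #|F t| * #|A|.-1 < #|P t|.
  move=> tT; apply: se; first by rewrite -card_gt0 F0.
  exact: leq_ltn_trans (FS t) Sg.
have cardSupp : #|Z| + \sum_(t in T) (#|P t| - #|Y t|) <= #|support amalgam S|.
  pose N := [set tx | (tx.1 \in T) && (tx.2 \in P tx.1) && (part tx.2 != i)].
  have cardN : \sum_(t in T) (#|P t| - #|Y t|) <= #|N|.
    rewrite card_pairs big_mkcond; apply: leq_sum => t _; case: ifP => // tT.
    rewrite leq_subLR -(cardsID [set x | part x == i] (P t)) leq_add //.
      rewrite -(card_imset (Y t) val_inj).
      apply/subset_leq_card/subsetP => x; rewrite !inE => /andP[xP xi].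
      by apply/imsetP; exists (exist _ x xi); rewrite ?inE.
    apply/subset_leq_card/subsetP => x; rewrite !inE => /andP[xi xP].
    by rewrite tT xP xi.
  have ZN : [set inl z | z in Z] :&: [set inr tx | tx in N] = set0 :> {set W + D * V}.
    by apply/setP => z; rewrite !inE; apply/andP => -[/imsetP[w _ ->] /imsetP[]].
  apply: leq_trans (leq_add (leqnn _) cardN) _.
  rewrite -(card_imset Z (@inl_inj W (D * V))) -(card_imset N (@inr_inj W (D * V))).
  rewrite -[leqLHS]subn0 -(cards0 (W + D * V)%type) -ZN -cardsU.
  apply/subset_leq_card/subsetP => z; rewrite inE => /orP[] /imsetP[].
    move=> w /bigcupP[t tT /imsetP[x]]; rewrite inE => /supportP[j jF [a xa]] -> ->.
    apply/supportP; exists (t, j); first by rewrite inE in jF.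
    by exists a; rewrite /amalgam /= -xa glueE.
  move=> -[t x]; rewrite inE /= => /andP[/andP[tT /supportP[j jF [a xa]]] xi] ->.
  apply/supportP; exists (t, j); first by rewrite inE in jF.
  by exists a; rewrite /amalgam /= -xa glue_out.
have YP t : #|Y t| <= #|P t|.
  rewrite -(card_imset _ val_inj).
  by apply/subset_leq_card/subsetP => x /imsetP[y]; rewrite inE => ? ->.
(* If fewer than [g] edges of [d] are involved, sparsity of [d] applies;
   otherwise each of them carries a single edge, meeting part [i] at most once. *)
have key : \sum_(t in T) #|Y t| < #|Z| + #|T|.
  have [Tg|Tg] := ltnP #|T| g.
    have T0' : T != set0 by rewrite -card_gt0.
    have := sd T T0' Tg.
    (* Completing each trace [Y t] to a full edge of [d] adds at most [#|X| - #|Y t|] points to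
       [Z]. *)
    have: #|support d T| <= #|Z| + \sum_(t in T) (#|X| - #|Y t|).
      have sub : support d T \subset
          Z :|: \bigcup_(t in T) [set d t x | x in ~: Y t].
        apply/subsetP => w /supportP[t tT [x ->]]; rewrite inE.
        have [xY|xY] := boolP (x \in Y t); apply/orP; [left|right];
          by apply/bigcupP; exists t => //; apply: imset_f; rewrite ?in_setC.
      apply: leq_trans (subset_leq_card sub) _.
      apply: leq_trans (leq_card_setU _ _) _; rewrite leq_add2l.
      apply: leq_trans (leq_card_bigcup _ _) _; apply: leq_sum => t _.
      by rewrite card_imset // -(cardsC (Y t)) addKn.
    have: \sum_(t in T) (#|X| - #|Y t|) + \sum_(t in T) #|Y t| = #|T| * #|X|.
      rewrite -big_split /= -sum_nat_const; apply: eq_bigr => t _.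
      by rewrite subnK ?max_card.
    have: #|T| * #|X| = #|T| * #|X|.-1 + #|T| by rewrite -mulnSr prednK.
    lia.
  have F1 t : t \in T -> #|F t| = 1.
    move=> tT; apply/eqP; rewrite eqn_leq F0 // andbT.
    have: #|F t| + \sum_(u in T | u != t) 1 <= #|T|.
      have: #|S| <= #|T| by apply: leq_trans Tg.
      rewrite cardS (bigD1 t) //=; apply: leq_trans; rewrite leq_add2l.
      by apply: leq_sum => u /andP[uT _]; apply: F0.
    by rewrite -[X in _ <= X]sum1_card [X in _ <= X](bigD1 t) //= leq_add2r.
  have Y1 t : t \in T -> #|Y t| <= 1.
    move=> /F1/eqP/cards1P[j Fj]; apply/card_le1_eqP => x y; rewrite !inE.
    rewrite /P Fj => /supportP[_ /set1P-> [a xa]] /supportP[_ /set1P-> [b yb]].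
    apply: val_inj; rewrite xa yb; congr (e j _); apply: (inj_part j) => /=.
    by rewrite -xa -yb (eqP (valP x)) (eqP (valP y)).
  have [Z0|Z0] := eqVneq Z set0.
    rewrite big1 => [|t tT]; first by rewrite ltn_addl.
    apply/eqP; rewrite cards_eq0 -subset0; apply/subsetP => x xY.
    have : d t x \in Z by apply/bigcupP; exists t => //; apply: imset_f.
    by rewrite Z0 inE.
  have: \sum_(t in T) #|Y t| <= \sum_(t in T) 1 by apply: leq_sum.
  rewrite sum1_card; move: Z0; rewrite -card_gt0; lia.
have sumP : \sum_(t in T) (#|P t| - #|Y t|) + \sum_(t in T) #|Y t| = \sum_(t in T) #|P t|.
  by rewrite -big_split /=; apply: eq_bigr => t _; rewrite subnK.
have : \sum_(t in T) (#|F t| * #|A|.-1 + 1) <= \sum_(t in T) #|P t|.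
  by apply: leq_sum => t tT; rewrite addn1 Pbig.
rewrite big_split /= sum1_card -big_distrl -cardS /=.
move: key cardSupp sumP.
move: (#|S| * _) #|support _ _| #|Z| #|T| (\sum_(t in T) #|P t|).
move: (\sum_(t in T) #|Y t|) (\sum_(t in T) _); lia.
Qed.

End Amalgam.

(** * Induction on the girth *)

(** The Ramsey property is used twice: on [W] it selects a copy [t] whose part [i] has a single
    colour [z], then inside that copy it handles the parts in [J]. The alphabet of the auxiliary
    family is part [i], whose size is not controlled, so [IH] ranges over all alphabets. *)
Lemma partite_system_step (g : nat) (A I K : finType) (i : I) (J : seq I) :
  0 < g -> 0 < #|A| -> (forall B : finType, 0 < #|B| -> has_system g B K) ->
  partite_system g.+1 A K J -> partite_system g.+1 A K (i :: J).
Proof.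
move=> g0 A0 IH [V [E [e [part [te se inj_part re]]]]].
pose X : finType := {x : V | part x == i}; have [X0|X0] := posnP #|X|.
  (* No edge meets an empty part, so the given system already serves. *)
  exists V, E, e, part; split=> // c; have [y Hy] := re c.
  exists y => s /Hy[j [js jy]]; exists j; split=> // a; rewrite inE.
  case/predU1P => [sai|/jy//].
  have ai : part (e j a) == i by rewrite js sai.
  have := card0_eq X0 (Sub (e j a) ai : X); by rewrite inE.
have [W [D [d [td rd sd]]]] := IH _ X0.
exists (W + D * V)%type, (D * E)%type, (amalgam e (part := part) (i := i) d),
  (@amalgam_part V I W D part i); split.
- exact: tranquil_amalgam.
- apply: sparse_amalgam => // t; exact: tranquil_family_inj.
- by move=> j a b /=; rewrite !amalgam_part_glue => /inj_part.
- move=> c; have [t [z tz]] := rd (c \o inl).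
  have [y Hy] := re (c \o glue d t).
  exists (fun i' => if i' == i then z else y i') => s /Hy[j [js jy]].
  exists (t, j); split=> a; first by rewrite amalgam_part_glue.
  rewrite inE; have [sai _|_ /= saJ] := eqVneq; last exact: jy.
  have ai : part (e j a) == i by rewrite js sai.
  by rewrite /amalgam (glueE d t (Sub (e j a) ai)); apply: tz.
Qed.

Lemma has_system_step (g : nat) (K : finType) (y0 : K) :
  0 < g -> (forall B : finType, 0 < #|B| -> has_system g B K) ->
  forall A : finType, 0 < #|A| -> has_system g.+1 A K.
Proof.
(* With [#|K| * #|A|] parts, each eventually assigned one colour, some colour is shared by at least
   [#|A|] parts; an edge running through such parts only is monochromatic. *)
move=> g0 IH A A0; pose I : finType := (K * A)%type.
have [J [JT [V [E [e [part [te se _ re]]]]]]] :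
  exists J : seq I, (forall x, x \in J) /\ partite_system g.+1 A K J.
  exists (enum I); split=> [x|]; first by rewrite mem_enum.
  elim: (enum I) => [|i J]; first exact: partite_system0.
  exact: partite_system_step.
exists V, E, e; split=> // c; have [y Hy] := re c.
have [z [s [inj_s sz]]] : exists z (s : A -> I), injective s /\ forall a, y (s a) = z.
  have [z Az] : exists z, #|A| <= #|[set x | y x == z]|.
    apply/existsP; apply: contraT; rewrite negb_exists => /forallP small.
    have: #|I| <= \sum_(z : K) #|A|.-1.
      rewrite -sum1_card (partition_big y xpredT) //=; apply: leq_sum => z _.
      by rewrite sum1dep_card -ltnS prednK // ltnNge small.
    rewrite sum_nat_const card_prod leq_pmul2l; last by apply/card_gt0P; exists y0.
    by rewrite leqNgt ltn_predL A0.
  exists z, (fun a => enum_val (widen_ord Az (enum_rank a))); split.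
    by move=> a b /enum_val_inj/(congr1 val)/= ab; apply/enum_rank_inj/val_inj.
  by move=> a; have := enum_valP (widen_ord Az (enum_rank a)); rewrite inE => /eqP.
have [j [_ jy]] := Hy s inj_s.
by exists j, z => a; rewrite jy ?JT.
Qed.

Lemma has_systems (g : nat) (A K : finType) (y0 : K) :
  0 < g -> 0 < #|A| -> has_system g A K.
Proof.
move=> + A0; case: g => // g _; elim: g A A0 => [|g IH] A A0.
  exact: has_system1.
exact: has_system_step.
Qed.

(** * From labelled families to hypergraphs *)

Lemma bridgeless_closed (r l : nat) (lam : 'I_l -> 'I_r * 'I_r) (V : Type) (v : 'I_l -> V) :
  (forall (T : finType) (f : 'I_r -> T), exists (U : finType) (q : V -> U),
    forall i, (q (v i) == q (v (ordS i))) = (f (lam i).1 == f (lam i).2)) ->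
  bridgeless lam.
Proof.
move=> H j; set R := (X in connect X).
have symR : connect_sym R.
  apply: sym_connect_sym => x y; apply: eq_existsb => i.
  by rewrite orbC.
have [U [q qE]] := H _ (root R).
rewrite -root_connect // -qE.
have Rq i : i != j -> q (v (ordS i)) = q (v i).
  move=> ij; apply/esym/eqP; rewrite qE root_connect //.
  by apply: connect1; apply/existsP; exists i; rewrite ij !eqxx.
(* Going round the walk from [ordS j], the class is constant until index [j] is reached, and
   reaching [j] gives the goal. *)
have claim n : q (v (iter n (@ordS l) (ordS j))) = q (v (ordS j)) \/
               q (v j) = q (v (ordS j)).
  elim: n => [|n [IH|]]; [by left| |by right].
  rewrite iterS; have [nj|/Rq->] := eqVneq (iter n (@ordS l) (ordS j)) j; last by left.
  by right; rewrite -IH nj.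
(* One step less than the order of [ordS] at [j] leads from [ordS j] back to [j]. *)
have := claim (order (@ordS l) j).-1.
rewrite -iterSr prednK ?order_gt0 // iter_order; last exact: ordS_inj.
by case=> ->.
Qed.

Section EdgeSets.

Variables (V E : finType) (r : nat) (e : E -> 'I_r -> V).

Definition edge_set : {set {set V}} := [set [set e j a | a : 'I_r] | j : E].

Lemma edge_setP F :
  reflect (exists j, F = [set e j a | a : 'I_r]) (F \in edge_set).
Proof. by apply: (iffP imsetP) => [[j _ ->]|[j ->]]; exists j. Qed.

Lemma uniform_edge_set : tranquil_family e -> uniform r edge_set.
Proof.
move=> te F /edge_setP[j ->]; rewrite card_imset ?card_ord //.
exact: tranquil_family_inj.
Qed.

Lemma tranquil_edge_set : 0 < r -> tranquil_family e -> tranquil r edge_set.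
Proof.
move=> r0 te; pose a0 := Ordinal r0.
(* Several indices may give the same vertex set; picking one makes the labelling depend on [F]
   alone. The default [a0] only concerns sets that are not edges and vertices outside [F]. *)
pose lam (F : {set V}) (x : V) : 'I_r :=
  if [pick j | F == [set e j a | a : 'I_r]] is Some j then
    odflt a0 [pick a | e j a == x]
  else a0.
have lamP F : F \in edge_set -> exists j, {in F, forall x, e j (lam F x) = x}.
  move=> /edge_setP[j Fj]; rewrite /lam; case: pickP => [k /eqP Fk|/(_ j)].
    exists k => x; rewrite Fk => /imsetP[a _ ->].
    by case: pickP => [b /eqP|/(_ a)] //=; rewrite eqxx.
  by rewrite Fj eqxx.
exists lam; split=> [F /lamP[j jK] x y xF yF xy|l v F [FE [vF _]]].
  by rewrite -(jK x xF) -(jK y yF) xy.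
apply: (@bridgeless_closed _ _ _ V v) => T f.
have [U [q qE]] := te T f; exists U, q => i /=.
have [j jK] := lamP _ (FE i); have [v1 v2] := vF i.
by rewrite -(qE j) !jK.
Qed.

Lemma chromatic_edge_set (k : nat) :
  ramsey_family 'I_k e -> chromatic_ge edge_set k.
Proof.
move=> re m mk [c cP].
have [j [z jz]] := re (widen_ord (ltnW mk) \o c).
have jE : [set e j a | a : 'I_r] \in edge_set by apply/edge_setP; exists j.
have [x [y [/imsetP[a _ ->] /imsetP[b _ ->] /negP[]]]] := cP _ jE.
by have := jz a; rewrite -(jz b) => /(congr1 val) /= ab; apply/eqP/val_inj.
Qed.

Lemma girth_edge_set (g : nat) :
  0 < r -> tranquil_family e -> sparse g e -> girth_ge edge_set g.
Proof.
move=> r0 te se l F x [l2 FE inj_F inj_x Fx]; rewrite leqNgt; apply/negP => lg.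
have /fin_all_exists[h hF] : forall i, exists j, F i = [set e j a | a : 'I_r].
  by move=> i; apply/edge_setP.
have inj_h : injective h by move=> i j ij; apply: inj_F; rewrite !hF ij.
pose S := [set h i | i : 'I_l].
have cardS : #|S| = l by rewrite card_imset // card_ord.
have S0 : S != set0 by rewrite -card_gt0 cardS ltnW.
have := se S S0; rewrite cardS card_ord => /(_ lg); apply/negP; rewrite -leqNgt.
(* Each edge of the cycle can give up its vertex [x i], which is still covered by the next edge;
   this leaves at most [l * r.-1] vertices, against sparsity. *)
have sub : support e S \subset \bigcup_(i : 'I_l) (F i :\ x i).
  apply/subsetP => y /supportP[_ /imsetP[i _ ->] [a ya]].
  have yF : y \in F i by rewrite hF ya; apply: imset_f.
  have [yx|yx] := eqVneq y (x i); last first.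
    by apply/bigcupP; exists i => //; rewrite !inE yx.
  apply/bigcupP; exists (ordS i) => //; rewrite yx !inE (Fx i).2 andbT.
  (* The next edge gives up a different vertex, because [2 <= l] forces [ordS i] to differ from [i],
     also at the wrap-around. *)
  rewrite (inj_eq inj_x) -(inj_eq val_inj) /=; have := ltn_ord i.
  rewrite leq_eqVlt => /predU1P[il|il]; last by rewrite modn_small //; lia.
  by rewrite il modnn; lia.
apply: leq_trans (subset_leq_card sub) _; apply: leq_trans (leq_card_bigcup _ _) _.
rewrite -[l in l * _]card_ord -sum_nat_const; apply: leq_sum => i _.
have := cardsD1 (x i) (F i); rewrite (Fx i).1 uniform_edge_set //; lia.
Qed.

End EdgeSets.

Theorem theorem3p4 (r k g : nat) :
  3 <= r -> 0 < k -> 0 < g ->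
  exists (V : finType) (E : {set {set V}}),
    [/\ uniform r E, tranquil r E, chromatic_ge E k & girth_ge E g].
Proof.
move=> r3 k0 g0; have r0 : 0 < r by apply: ltn_trans r3.
have [|V [E [e [te re se]]]] := @has_systems g 'I_r 'I_k (Ordinal k0) g0.
  by rewrite card_ord.
exists V, (edge_set e); split.
- exact: uniform_edge_set.
- exact: tranquil_edge_set.
- exact: chromatic_edge_set.
- exact: girth_edge_set.
Qed.
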